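(* Let $n,m \in \mathbb{Z}^+$ with $n \geq 2$ and $m \geq 1$, and let $T_m$ be the rooted complete $m$-ary tree of infinite height. Then \[ \chi_{(n)}(T_m) = \begin{cases} 2, &\text{if } n \nmid m \text{ and } n \nmid (m+1), \\ 4, &\text{if } n = 2 \text{ and } m \text{ is odd}, \\ 3, &\text{otherwise}. \end{cases}\]
   Context: $T_m$ is the infinite rooted tree in which every vertex has exactly $m$ children. For a graph $G=(V,E)$, a $\mathbb{Z}$-labeling is a map $\ell:V\to\mathbb{Z}$; its order is the size of its range; it is proper if adjacent vertices get different labels. $N(v)$ is the open neighborhood of $v$. An open coloring with nonzero remainders mod $n$ is a labeling with $\sum_{w\in N(v)}\ell(w)\not\equiv 0 \pmod n$ for all $v\in V$. $\chi_{(n)}(G)$ is the minimum order of a proper open coloring with nonzero remainders mod $n$ of $G$. *)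

(* Defs.v *)
From HB Require Import structures.
From mathcomp Require Import all_boot all_order all_algebra.
From mathcomp Require Import all_classical.
Set Implicit Arguments.
Unset Strict Implicit.
Unset Printing Implicit Defensive.
Import GRing.Theory.
Local Open Scope ring_scope.
Local Open Scope classical_set_scope.

(* Local finiteness makes the sums over open neighborhoods genuine finite
   sums. *)
Record lfgraph := LFGraph {
  vertex :> choiceType;
  adj : rel vertex;
  adj_sym : symmetric adj;
  adj_irr : irreflexive adj;
  adj_fin : forall v, finite_set [set w | adj v w]
}.

Definition open_nbhd (G : lfgraph) (v : G) : set G := [set w | adj v w].

Definition proper (G : lfgraph) (l : G -> int) : Prop :=
  forall u v : G, adj u v -> l u <> l v.

Definition open_coloring_nz (n : nat) (G : lfgraph) (l : G -> int) : Prop :=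
  forall v : G, (\sum_(w \in open_nbhd v) l w != 0 %[mod n])%Z.

(* chi_(n)(G) = k. The order of a labeling is the cardinality of its range;
   labelings of infinite order also compete in the minimum. *)
Definition is_chi (n : nat) (G : lfgraph) (k : nat) : Prop :=
  (exists l : G -> int,
     [/\ proper l, open_coloring_nz n l & (range l #= `I_k)%card]) /\
  (forall l : G -> int,
     proper l -> open_coloring_nz n l -> (`I_k #<= range l)%card).

(* The vertices of T_m are the finite words over 'I_m: the root is [::] and
   the m children of u are the words i :: u. *)
Definition is_child (m : nat) (u v : seq 'I_m) : bool :=
  [exists i : 'I_m, v == i :: u].

Definition tree_adj (m : nat) : rel (seq 'I_m) :=
  fun u v => is_child u v || is_child v u.

Lemma tree_adj_sym m : symmetric (@tree_adj m).
Proof. by move=> u v; rewrite /tree_adj orbC. Qed.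

Lemma tree_adj_irr m : irreflexive (@tree_adj m).
Proof.
move=> u; rewrite /tree_adj orbb; apply/negbTE/existsP => -[i /eqP].
by move/(congr1 size) => /= /n_Sn.
Qed.

Lemma tree_adj_fin m (v : seq 'I_m) : finite_set [set w | tree_adj v w].
Proof.
apply: (@sub_finite_set _ _ [set` behead v :: [seq i :: v | i <- enum 'I_m]]).
  move=> w /orP[] /existsP[i /eqP ->] /=; rewrite inE.
    by apply/orP; right; apply: map_f; rewrite mem_enum.
  by rewrite eqxx.
exact: finite_seq.
Qed.

Definition tree (m : nat) : lfgraph :=
  LFGraph (@tree_adj_sym m) (@tree_adj_irr m) (@tree_adj_fin m).

(* Main.v *)
(* Lower bounds.  A vertex whose degree is a multiple of n must have two
   neighbors with different labels, which together with its own label makes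
   three; this applies to the root if n | m and to the other vertices if
   n | m + 1.  If n = 2 and m is odd, every vertex has a neighbor with odd label
   and every non-root vertex also one with even label, so some edge has two odd
   labels and some edge has two even ones.

   Upper bounds.  Let x be a 0-1 labeling with sum exactly 1 over every open
   neighborhood.
   - n divides neither m nor m + 1: 1 and n + 1, according to the parity of the
     depth.
   - n | m: n + 1 at even depth, x at odd depth.
   - n = 2, m odd: x, plus 2 at odd depth.
   - n | m + 1, n > 2: labels 0, 1, 2; the root gets 0 and its children 1;
     below, one child of a vertex gets the label different from those of the
     vertex and its parent, the other children get the label of the parent.
     If a, b, c are the labels of the parent, the vertex and that child, the
     neighborhood sum is m a + c, congruent to c - a. *)
Require Import Defs.
From mathcomp Require Import all_boot.
From mathcomp Require Import all_order all_algebra.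
From mathcomp Require Import all_classical.
From mathcomp Require Import zify ring.
Import Defs.
Set Implicit Arguments.
Unset Strict Implicit.
Unset Printing Implicit Defensive.

Section TreeColorings.
Import GRing.Theory.
Local Open Scope ring_scope.
Local Open Scope classical_set_scope.

(** * Orders of labelings via lists of values *)

Lemma card_le_set_seq (T : choiceType) (A : set T) (s : seq T) :
  A `<=` [set` s] -> (A #<= `I_(size s))%card.
Proof.
case: s => [|x0 s] sA.
  by rewrite (_ : A = set0) ?card_ge0//; apply/seteqP; split=> a // /sA.
apply: card_le_trans (card_image_le (nth x0 (x0 :: s)) _).
apply: subset_card_le => a /sA /= as_; exists (index a (x0 :: s)).
  by rewrite -index_mem in as_.
by rewrite nth_index.
Qed.

Lemma card_ge_set_seq (T : choiceType) (A : set T) (s : seq T) :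
  uniq s -> [set` s] `<=` A -> (`I_(size s) #<= A)%card.
Proof.
case: s => [|x0 s] us sA; first by rewrite II0 card_ge0.
apply: card_le_trans (subset_card_le sA).
apply: card_le_trans (card_image_le (index^~ (x0 :: s)) _).
apply: subset_card_le => i lti; exists (nth x0 (x0 :: s) i).
  exact: mem_nth.
exact: (index_uniq x0 lti us).
Qed.

(** The lower bound also applies to [l], so [s] only has to contain its values: that they fill a set
    of [size s] elements then comes for free. *)
Lemma is_chi_seq (n : nat) (G : lfgraph) (s : seq int) (l : G -> int) :
    proper l -> open_coloring_nz n l -> (forall v, l v \in s) ->
    (forall l' : G -> int, proper l' -> open_coloring_nz n l' ->
       (`I_(size s) #<= range l')%card) ->
  is_chi n G (size s).
Proof.
move=> lP lO ls lb; split=> //; exists l; split=> //.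
rewrite card_eq_le lb// andbT; apply: card_le_set_seq => _ [v _ <-].
exact: ls.
Qed.

(** * Neighborhoods and neighborhood sums in the tree *)

Definition tree_nbrs m (v : seq 'I_m) : seq (seq 'I_m) :=
  let children := [seq i :: v | i <- enum 'I_m] in
  if v is _ :: u then u :: children else children.

Lemma mem_tree_nbrs m (v w : seq 'I_m) : (w \in tree_nbrs v) = tree_adj v w.
Proof.
have childE : (w \in [seq i :: v | i <- enum 'I_m]) = is_child v w.
  rewrite /is_child; apply/mapP/existsP => [[i _ ->]|[i /eqP ->]].
    by exists i.
  by exists i; rewrite ?mem_enum.
rewrite /tree_nbrs /tree_adj; case: v childE => [|j u] childE.
  rewrite childE; case: (is_child _ _) => //=.
  by apply/esym/negbTE/existsP => -[].
rewrite inE childE orbC /is_child; congr (_ || _).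
apply/eqP/existsP => [->|[i /eqP[_ ->]]//]; by exists j.
Qed.

Lemma uniq_tree_nbrs m (v : seq 'I_m) : uniq (tree_nbrs v).
Proof.
have uc : uniq [seq i :: v | i <- enum 'I_m].
  by rewrite map_inj_uniq ?enum_uniq// => i j [].
case: v uc => [|j u] //= ->; rewrite andbT.
by apply/mapP => -[i _ /(congr1 size)] /=; lia.
Qed.

Lemma sum_tree_nbrs m (v : tree m) (l : tree m -> int) :
  \sum_(w \in open_nbhd v) l w = \sum_(w <- tree_nbrs v) l w.
Proof.
rewrite [RHS](@fsbig_seq _ _ _ (tree m)) ?uniq_tree_nbrs//; apply: eq_fsbigl.
by apply/seteqP; split=> w /=; rewrite mem_tree_nbrs.
Qed.

Lemma sum_nbhd_root m (l : tree m -> int) :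
  \sum_(w \in open_nbhd ([::] : tree m)) l w = \sum_(i < m) l [:: i].
Proof. by rewrite sum_tree_nbrs /= big_map big_enum. Qed.

Lemma sum_nbhd_cons m (l : tree m -> int) j (u : seq 'I_m) :
  \sum_(w \in open_nbhd (j :: u : tree m)) l w =
  l u + \sum_(i < m) l [:: i, j & u].
Proof. by rewrite sum_tree_nbrs /= big_cons big_map big_enum. Qed.

Lemma proper_treeP m (l : tree m -> int) :
  proper l <-> forall i (u : seq 'I_m), l (i :: u) != l u.
Proof.
split=> [lP i u|lP u v].
  apply/eqP; apply: lP; rewrite /adj /= /tree_adj orbC.
  by apply/orP; left; apply/existsP; exists i.
case/orP=> /existsP[i /eqP ->]; apply/eqP; last exact: lP.
by rewrite eq_sym.
Qed.

Lemma nz_treeP (n m : nat) (l : tree m -> int) :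
    ~~ (n %| \sum_(i < m) l [:: i])%Z ->
    (forall j (u : seq 'I_m), ~~ (n %| l u + \sum_(i < m) l [:: i, j & u])%Z) ->
  open_coloring_nz n l.
Proof.
move=> l0 l1 v; rewrite eqz_mod_dvd subr0.
by case: v => [|j u]; rewrite ?sum_nbhd_root ?sum_nbhd_cons.
Qed.

Lemma sum_first_other m (a b : int) : (0 < m)%N ->
  \sum_(i < m) (if i == 0%N :> nat then a else b) = a + b *+ m.-1.
Proof.
case: m => // m _; rewrite big_ord_recl /=; congr (_ + _).
by rewrite sumr_const card_ord.
Qed.

(** * Lower bounds *)

Lemma card_range_ge2 m (l : tree m -> int) :
  (0 < m)%N -> proper l -> (`I_2 #<= range l)%card.
Proof.
move=> m0 /proper_treeP lP; pose i0 := Ordinal m0.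
apply: (@card_ge_set_seq _ _ [:: l [:: i0]; l [::]]).
  by rewrite /= inE lP.
by move=> x /=; rewrite !inE => /orP[] /eqP ->; [exists [:: i0]|exists [::]].
Qed.

Lemma card_range_ge3 (n m : nat) (l : tree m -> int) (v : seq 'I_m) :
    proper l -> open_coloring_nz n l -> (n %| size (tree_nbrs v))%N ->
  (`I_3 #<= range l)%card.
Proof.
move=> lP lO nv.
have [w1 [w2 [w1v w2v l12]]] : exists w1 w2,
    [/\ w1 \in tree_nbrs v, w2 \in tree_nbrs v & l w1 != l w2].
  apply: contrapT => lconst; have /negP := lO v; apply.
  rewrite eqz_mod_dvd subr0 sum_tree_nbrs.
  case E: (tree_nbrs v) => [|w0 s]; first by rewrite big_nil dvdz0.
  rewrite -E (eq_big_seq (fun=> l w0)); last first.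
    move=> w wv; apply/eqP; apply: contrapT => /negP lw; apply: lconst.
    by exists w, w0; split=> //; rewrite E mem_head.
  rewrite big_const_seq count_predT iter_addr_0 -mulr_natl natz.
  exact: dvdz_mulr.
have lN w : w \in tree_nbrs v -> l v != l w.
  by rewrite mem_tree_nbrs => vw; apply/eqP; exact: (lP v w vw).
apply: (@card_ge_set_seq _ _ [:: l v; l w1; l w2]).
  rewrite /= !inE l12 andbT negb_or.
  by rewrite !lN.
by move=> x /=; rewrite !inE => /or3P[] /eqP ->; [exists v|exists w1|exists w2].
Qed.

Lemma exists_odd_nbr m (l : tree m -> int) (v : seq 'I_m) :
  open_coloring_nz 2 l -> exists2 w, tree_adj v w & ~~ (2 %| l w)%Z.
Proof.
move=> lO; apply: contrapT => lev; have /negP := lO v; apply.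
rewrite eqz_mod_dvd subr0 sum_tree_nbrs big_seq.
apply: rpred_sum => w; rewrite mem_tree_nbrs => vw.
by apply: contrapT => /negP lw; apply: lev; exists w.
Qed.

Lemma exists_even_nbr m (l : tree m -> int) (v : seq 'I_m) :
    odd m -> v != [::] -> open_coloring_nz 2 l ->
  exists2 w, tree_adj v w & (2 %| l w)%Z.
Proof.
move=> modd v0 lO; apply: contrapT => lodd; have /negP := lO v; apply.
rewrite eqz_mod_dvd subr0 sum_tree_nbrs.
(* If all labels are odd, subtracting 1 from each leaves even terms, and the total subtracted is the
   degree m + 1, which is even. *)
have -> : \sum_(w <- tree_nbrs v) l w =
    \sum_(w <- tree_nbrs v) (l w - 1) + (size (tree_nbrs v))%:Z.
  rewrite sumrB big_const_seq count_predT iter_addr_0 -natz; ring.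
apply: rpredD; last first.
  case: v v0 {lodd} => // j u _.
  rewrite /= size_map size_enum_ord; change (is_true (2 %| m.+1)%N).
  by rewrite dvdn2 /= modd.
rewrite big_seq; apply: rpred_sum => w.
rewrite mem_tree_nbrs => vw.
have lw : ~ (2 %| l w)%Z by move=> lw; apply: lodd; exists w.
change (is_true (2 %| l w - 1)%Z); lia.
Qed.

Lemma card_range_ge4 m (l : tree m -> int) :
    odd m -> proper l -> open_coloring_nz 2 l -> (`I_4 #<= range l)%card.
Proof.
move=> modd lP lO; pose i0 := Ordinal (odd_gt0 modd).
have [w0 _ lw0] := exists_odd_nbr [::] lO.
have [w1 w01 lw1] := exists_odd_nbr w0 lO.
(* Neighbors of a vertex at depth 2 lie at depth 1 or 3, so [u0] is not the root and has an even
   neighbor in turn. *)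
have [u0 uu0 lu0] := @exists_even_nbr _ l [:: i0; i0] modd isT lO.
have u00 : u0 != [::].
  apply: contraTneq uu0 => ->; rewrite -mem_tree_nbrs /= inE.
  by apply/mapP => -[].
have [u1 u01 lu1] := exists_even_nbr modd u00 lO.
have /eqP l01 := lP _ _ w01; have /eqP k01 := lP _ _ u01.
apply: (@card_ge_set_seq _ _ [:: l w0; l w1; l u0; l u1]).
  rewrite /= !inE !negb_or l01 k01 /= !andbT.
  by apply/andP; split; apply/andP; split;
    [apply: contraNneq lw0 => ->|apply: contraNneq lw0 => ->
    |apply: contraNneq lw1 => ->|apply: contraNneq lw1 => ->].
by move=> x /=; rewrite !inE => /or4P[] /eqP ->;
  [exists w0|exists w1|exists u0|exists u1].
Qed.

(** * Labelings attaining the bounds *)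

Fixpoint perfect_dom m (v : seq 'I_m) : int :=
  if v is i :: u then
    if i == 0%N :> nat then if u is _ :: w then 1 - perfect_dom w else 1 else 0
  else 0.

Lemma perfect_dom01 m (v : seq 'I_m) : perfect_dom v \in [:: 0; 1].
Proof.
(* The recursion drops two letters at a time, hence strong induction on the length. *)
have [k] := ubnP (size v); elim: k v => // k IH [|i [|j w]] //= sw;
  case: ifP => // _.
have /IH : (size w < k)%N by lia.
by rewrite !inE => /orP[] /eqP ->.
Qed.

Lemma sum_perfect_dom_root m : (0 < m)%N -> \sum_(i < m) perfect_dom [:: i] = 1.
Proof. by move=> m0; rewrite sum_first_other// mul0rn addr0. Qed.

(** Of the children of [j :: u] only the one numbered 0 can be labeled 1, and its label is one minus
    that of [u]. With the root case, the vertices labeled 1 form a perfect total dominating set. *)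
Lemma sum_perfect_dom_cons m j (u : seq 'I_m) : (0 < m)%N ->
  perfect_dom u + \sum_(i < m) perfect_dom [:: i, j & u] = 1.
Proof. by move=> m0; rewrite sum_first_other// mul0rn; ring. Qed.

Lemma chi_tree2 (n m : nat) : (1 < n)%N -> (0 < m)%N -> ~~ (n %| m)%N ->
  ~~ (n %| m.+1)%N -> is_chi n (tree m) 2.
Proof.
move=> n1 m0 nm nm1.
pose c (v : tree m) : nat := if odd (size v) then n.+1 else 1.
(* Each neighborhood sum is the degree times a value of [c], so by coprimality n divides it only if
   n divides the degree. *)
have cn v : coprime n (c v).
  by rewrite /c; case: ifP; rewrite ?coprimenS ?coprimen1.
apply: (@is_chi_seq _ _ [:: 1; n.+1%:Z] (Posz \o c)).
- by apply/proper_treeP => i u; rewrite /c /=; case: (odd (size u)) => /=; lia.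
- apply: nz_treeP => [|j u].
    rewrite (eq_bigr (fun=> n.+1%:Z))// sumr_const card_ord -mulr_natl natz.
    by rewrite -PoszM dvdzE /= Gauss_dvdl ?coprimenS.
  rewrite (eq_bigr (fun=> (c u)%:Z)) => [|i _]; last by rewrite /c /= negbK.
  rewrite sumr_const card_ord -mulrS -mulr_natl natz.
  by rewrite -PoszM dvdzE /= Gauss_dvdl ?cn.
- by move=> v; rewrite /= /c !inE; case: ifP; rewrite eqxx ?orbT.
- by move=> l' lP _; exact: card_range_ge2.
Qed.

Lemma chi_tree3_dvdn (n m : nat) : (1 < n)%N -> (0 < m)%N -> (n %| m)%N ->
  is_chi n (tree m) 3.
Proof.
move=> n1 m0 nm.
(* n + 1 is congruent to 1 mod n but differs from both values of [perfect_dom]. *)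
pose l (v : tree m) : int := if odd (size v) then perfect_dom v else n.+1%:Z.
apply: (@is_chi_seq _ _ [:: 0; 1; n.+1%:Z] l).
- apply/proper_treeP => i u; rewrite /l /=; case: (odd (size u)) => /=.
    by move: (perfect_dom01 u); rewrite !inE; lia.
  by move: (perfect_dom01 (i :: u)); rewrite !inE /=; lia.
- apply: nz_treeP => [|j u].
    by rewrite /l /= sum_perfect_dom_root// dvdz1 /=; lia.
  rewrite /l /= negbK; case: ifP => _.
    by rewrite sum_perfect_dom_cons// dvdz1 /=; lia.
  rewrite sumr_const card_ord -mulrS -mulr_natl natz -PoszM dvdzE /=.
  by rewrite Gauss_dvdl ?coprimenS// -addn1 dvdn_addr// dvdn1; lia.
- move=> v; rewrite /l; case: ifP => _; last by rewrite !inE eqxx !orbT.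
  by move: (perfect_dom01 v); rewrite !inE => /orP[] ->; rewrite ?orbT.
- move=> l' lP lO; apply: (card_range_ge3 lP lO (v := [::])).
  by rewrite /= size_map size_enum_ord.
Qed.

(** Since 0 + 1 + 2 = 3, the label different from two distinct ones is 3 minus both. *)
Fixpoint rainbow m (v : seq 'I_m) : int :=
  if v is i :: u then
    if u is _ :: w then
      if i == 0%N :> nat then 3 - rainbow u - rainbow w else rainbow w
    else 1
  else 0.

(** Range and properness need a joint induction: 3 minus two labels is the third one only if these
    are distinct elements of {0, 1, 2}. *)
Lemma rainbow012 m i (u : seq 'I_m) :
  [/\ rainbow u \in [:: 0; 1; 2], rainbow (i :: u) \in [:: 0; 1; 2]
    & rainbow (i :: u) != rainbow u].
Proof.
elim: u i => [|j u IH] i //=.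
have [] := IH j; rewrite /= => ru rju neq; split=> //.
- by case: ifP => _ //; move: ru rju neq; rewrite !inE; lia.
- by case: ifP => _; rewrite 1?eq_sym//; move: ru rju neq; rewrite !inE; lia.
Qed.

Lemma chi_tree3_dvdnS (n m : nat) : (2 < n)%N -> (0 < m)%N -> (n %| m.+1)%N ->
  is_chi n (tree m) 3.
Proof.
move=> n2 m0 nm1.
apply: (@is_chi_seq _ (tree m) [:: 0; 1; 2] (@rainbow m)).
- by apply/proper_treeP => i u; have [] := rainbow012 i u.
- apply: nz_treeP => [|j u] /=.
    (* The root sum is m, and n > 1 cannot divide both m and m + 1. *)
    rewrite sumr_const card_ord natz dvdzE /=.
    by apply/negP => nm; move: nm1; rewrite -addn1 dvdn_addr// dvdn1; lia.
  rewrite sum_first_other//.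
  have [] := rainbow012 j u; rewrite /=.
  set a := rainbow u; set b := (if u is _ :: _ then _ else _) => ua ub neq.
  (* With c = 3 - b - a the label of child 0, the last term is c - a: nonzero as c differs from a,
     and at most 2 < n in absolute value. *)
  have -> : a + (3 - b - a + a *+ m.-1) = a * m.+1%:Z + (3 - b - 2 * a).
    by rewrite -mulr_natl natz -[in m.+1](prednK m0); lia.
  rewrite rpredDl ?dvdz_mull//.
  rewrite dvdzE gtnNdvd//; move: ua ub neq; rewrite !inE; lia.
- by move=> [|i u] //; have [] := rainbow012 i u.
- move=> l' lP lO; apply: (card_range_ge3 lP lO (v := [:: Ordinal m0])).
  by rewrite /= size_map size_enum_ord.
Qed.

Lemma chi_tree4 m : odd m -> is_chi 2 (tree m) 4.
Proof.
move=> modd; have m0 := odd_gt0 modd.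
(* Adding 2 preserves the parity of every sum and separates 2, 3 at odd depth from 0, 1 at even
   depth. *)
pose l (v : tree m) : int := perfect_dom v + (if odd (size v) then 2 else 0).
apply: (@is_chi_seq _ _ [:: 0; 1; 2; 3] l).
- apply/proper_treeP => i u; rewrite /l.
  move: (perfect_dom01 u) (perfect_dom01 (i :: u)); rewrite !inE /=.
  by case: (odd (size u)) => /=; lia.
- apply: nz_treeP => [|j u]; rewrite /l big_split /= sumr_const card_ord.
    by rewrite sum_perfect_dom_root//; lia.
  rewrite negbK addrACA sum_perfect_dom_cons//; lia.
- move=> v; rewrite /l; move: (perfect_dom01 v); rewrite !inE.
  by case: (odd (size v)); lia.
- by move=> l' lP lO; exact: card_range_ge4.
Qed.

End TreeColorings.

Theorem theorem8p3 (n m : nat) (hn : 2 <= n) (hm : 1 <= m) :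
  is_chi n (tree m)
    (if ~~ (n %| m) && ~~ (n %| m.+1) then 2
     else if (n == 2) && odd m then 4
     else 3).
Proof.
have [nm|nm] := boolP (n %| m).
  have -> : (n == 2) && odd m = false.
    by apply/negbTE/andP => -[/eqP n2]; move: nm; rewrite n2 dvdn2 => /negPf ->.
  exact: chi_tree3_dvdn.
have [nm1|nm1] := boolP (n %| m.+1); last exact: chi_tree2.
have [n2|n2] := eqVneq n 2 => /=.
  by move: nm; rewrite n2 dvdn2 negbK => modd; rewrite modd; exact: chi_tree4.
by apply: chi_tree3_dvdnS; rewrite // ltn_neqAle eq_sym n2.
Qed.
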